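(* Assume that $F$ is $\mu$-strongly convex and $\eta$-smooth with $0<\mu<\eta$, that every consensus matrix satisfies the conditions listed in the context, and that there are constants $c_1\ge0$, $c_2\ge1$ with $\|\nabla f_i(\mathbf x)\|^2\le c_1+c_2\|\nabla F(\mathbf x)\|^2$ for all end devices $i$ and all $\mathbf x\in\mathbb R^M$. Let the step size be $\beta=1/\eta$. Then for every realization of MH-FL with cluster sampling and every $k\ge1$, $$F(\mathbf w^{(k)})-F(\mathbf w^* )\le\left[\prod_{l=1}^{k}\Big(1-\frac\mu\eta+\frac{8c_2}{D^2}\big(D-D_s^{(l)}\big)^2\Big)\right]\big(F(\mathbf w^{(0)})-F(\mathbf w^* )\big)$$ $$\quad+\sum_{t=1}^{k}\left[\prod_{l=t+1}^{k}\Big(1-\frac\mu\eta+\frac{8c_2}{D^2}\big(D-D_s^{(l)}\big)^2\Big)\right]\left(\frac{\eta\,\Phi}{\big(D_s^{(t)}\big)^2}\,\Xi^{(t)}+\frac4\eta\Big(\frac{D-D_s^{(t)}}{D}\Big)^2c_1\right),$$ where an empty product equals $1$, $\Phi=N_{J-1}+\cdots+N_1+N_0$ (with $N_0=1$), $D_s^{(t)}$ is the total number of data points of the end devices in active clusters at iteration $t$, and $$\Xi^{(t)}=\sum_{j=0}^{J-1}\ \sum_{n\in\mathcal N_j}\mathbb 1^{(t)}_{\{Q(n)\}}\,|\mathcal Q^{(t)}(n)|^3\,\big(\lambda^{(t)}_{Q(n)}\big)^{2\theta^{(t)}_{Q(n)}}\big(\Upsilon^{(t)}_{Q(n)}\big)^2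 ,$$ with $\mathbb 1^{(t)}_{\{C\}}=1$ if cluster $C$ is both active and in LUT mode at iteration $t$, and $0$ otherwise.
   Context: **Network.** Fix an integer $J\ge 1$ (the number of layers below the server). For $0\le j\le J$ let $\mathcal N_j$ be a finite nonempty set (the nodes of layer $j$), $N_j=|\mathcal N_j|$; $\mathcal N_0=\{0\}$ is the main server, so $N_0=1$; $\mathcal N_J$ are the end devices. At each global iteration $k\ge1$, each node $n\in\mathcal N_j$, $0\le j\le J-1$, has a nonempty set of children $\mathcal Q^{(k)}(n)\subseteq\mathcal N_{j+1}$, and the sets $\mathcal Q^{(k)}(n)$, $n\in\mathcal N_j$, partition $\mathcal N_{j+1}$ (they may change with $k$). The cluster below $n$ is denoted $Q(n)$; its node set at iteration $k$ is $\mathcal Q^{(k)}(n)$. Thus clusters of layer $j+1$ are in bijection with nodes of layer $j$. At iteration $k$ each cluster $C$ operates either in LUT mode or in EUT mode. **Loss.** Each end device $n\in\mathcal N_J$ has a finite nonempty dataset $\mathcal D_n$ and a differentiable local loss $f_n:\mathbb R^M\to\mathbb R$. Put $D=\sum_{n\in\mathcal N_J}|\mathcal D_n|$, $F(\mathbf w)=\frac1D\sum_{n\in\mathcal N_J}|\mathcal D_n|f_n(\mathbf w)$, and $\mathbf w^*=\arg\min_{\mathbf w\in\mathbb R^M}F(\mathbf w)$. $\mu$-strong convexity: $F(\mathbf y)\ge F(\mathbf x)+(\mathbf y-\mathbf x)^\top\nabla F(\mathbf x)+\frac\mu2\|\mathbf y-\mathbf x\|^2$ for all $\mathbf x,\mathbf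 y$; $\eta$-smoothness: $\|\nabla F(\mathbf x)-\nabla F(\mathbf y)\|\le\eta\|\mathbf x-\mathbf y\|$ for all $\mathbf x,\mathbf y$. $\|\cdot\|$ is the Euclidean norm. **Consensus matrices.** For a cluster $C$ with node set $\mathcal C^{(k)}$ that is LUT at iteration $k$, there is a connected undirected graph $G_C^{(k)}$ on $\mathcal C^{(k)}$, a number of device-to-device (D2D) rounds $\theta^{(k)}_C\in\{0,1,2,\dots\}$, and a real matrix $\mathbf V^{(k)}_C$ indexed by $\mathcal C^{(k)}$ with: (i) $(\mathbf V_C^{(k)})_{m,n}=0$ if $m\ne n$ are not adjacent in $G_C^{(k)}$; (ii) $\mathbf V_C^{(k)}\mathbf 1=\mathbf 1$; (iii) $\mathbf V_C^{(k)}$ is symmetric; (iv) the spectral radius satisfies $\rho\big(\mathbf V_C^{(k)}-\mathbf 1\mathbf 1^\top/|\mathcal C^{(k)}|\big)\le\lambda^{(k)}_C<1$ for a given number $\lambda_C^{(k)}$. (Convention $0^0=1$.) **Cluster sampling.** At each iteration $k$ the server engages an arbitrary nonempty set of clusters of the bottom layer $J$, called active; the other bottom clusters are passive. A node is active if it lies on a path between an active bottom cluster and the server (end devices are active iff their cluster is active), and passive otherwise; a cluster of a layer $j<J$ is active if it contains at least one active node. $D_s^{(k)}=\sum|\mathcal D_n|$, the sum being over end devices $n$ in active clusters. **MH-FL with cluster sampling.** Start from $\mathbf w^{(0)}\in\mathbb R^M$. At iteration $k\ge1$, each active end device $n$ sets $\widetilde{\mathbf w}_n^{(k)}=|\mathcal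 D_n|\big(\mathbf w^{(k-1)}-\beta\nabla f_n(\mathbf w^{(k-1)})\big)$; passive nodes contribute the zero vector, $\widetilde{\mathbf w}_n^{(k)}=\mathbf 0$. Then for $j=J-1,\dots,0$ each active node $n\in\mathcal N_j$ with child cluster $C=Q(n)$ obtains $\widetilde{\mathbf w}_n^{(k)}$ as follows. If $C$ is EUT: $\widetilde{\mathbf w}_n^{(k)}=\sum_{i\in\mathcal Q^{(k)}(n)}\widetilde{\mathbf w}_i^{(k)}$. If $C$ is LUT: with $\widetilde{\mathbf W}_C^{(k)}$ the matrix of rows $\widetilde{\mathbf w}_i^{(k)}$, $i\in\mathcal Q^{(k)}(n)$, and $\widehat{\mathbf W}_C^{(k)}=(\mathbf V_C^{(k)})^{\theta_C^{(k)}}\widetilde{\mathbf W}_C^{(k)}$ with rows $\widehat{\mathbf w}_i^{(k)}$, the parent samples one (arbitrary) child $n'\in\mathcal Q^{(k)}(n)$ and sets $\widetilde{\mathbf w}_n^{(k)}=|\mathcal Q^{(k)}(n)|\widehat{\mathbf w}_{n'}^{(k)}$. The server sets $\mathbf w^{(k)}=\widetilde{\mathbf w}_0^{(k)}/D_s^{(k)}$. A realization is any choice of active clusters and sampled children. **Divergence.** For each cluster $C$ and iteration $k$, $\Upsilon_C^{(k)}$ is a number with $\|\widetilde{\mathbf w}_q^{(k)}-\widetilde{\mathbf w}_{q'}^{(k)}\|\le\Upsilon_C^{(k)}$ for all $q,q'\in\mathcal C^{(k)}$. *)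

(* Defs.v *)
From mathcomp Require Import all_boot all_order all_algebra.
From mathcomp Require Import complex.
From mathcomp Require Import boolp classical_sets reals topology normedtype derive.

Set Implicit Arguments.
Unset Strict Implicit.
Unset Printing Implicit Defensive.

Import Order.TTheory GRing.Theory Num.Theory numFieldNormedType.Exports.

Local Open Scope ring_scope.

(** Vectors of R^M are row vectors.  The library norm [`|x|] on ['rV[R]_M] is
    the sup norm, hence a separate Euclidean norm; [differentiable] does not
    depend on this choice. *)

Definition enorm (R : realType) (M : nat) (x : 'rV[R]_M) : R :=
  Num.sqrt (\sum_(i < M) x 0 i ^+ 2).

Definition grad (R : realType) (M : nat) (F : 'rV[R]_M -> R) (x : 'rV[R]_M) :
    'rV[R]_M :=
  \row_i 'D_(delta_mx 0 i) F x.

Definition strongly_convex (R : realType) (M : nat) (mu : R)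
    (F : 'rV[R]_M -> R) : Prop :=
  forall x y : 'rV[R]_M,
    F x + ((y - x) *m (grad F x)^T) 0 0 + mu / 2 * enorm (y - x) ^+ 2 <= F y.

Definition smooth (R : realType) (M : nat) (eta : R) (F : 'rV[R]_M -> R) :
    Prop :=
  forall x y : 'rV[R]_M, enorm (grad F x - grad F y) <= eta * enorm (x - y).

(** The largest modulus of a complex eigenvalue. *)
Definition spectral_radius (R : realType) (n : nat) (A : 'M[R]_n) : R :=
  sup [set complex.Re `|z| | z in
        [set z : R[i] | eigenvalue (map_mx (@real_complex R) A) z]]%classic.

Definition connected_graph_on (T : finType) (C : {set T}) (G : rel T) : Prop :=
  {in C &, symmetric G} /\
  {in C &, forall a b : T,
     connect [rel x y | [&& x \in C, y \in C & G x y]] a b}.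

(** A matrix indexed by the nodes of [C] is an element of ['M_#|C|]: the index
    [a : 'I_#|C|] stands for the node [enum_val a]. *)
Definition consensus_matrix (R : realType) (T : finType) (C : {set T})
    (G : rel T) (lambda : R) (V : 'M[R]_#|C|) : Prop :=
  [/\ forall a b : 'I_#|C|,
        a != b -> ~~ G (enum_val a) (enum_val b) -> V a b = 0,
      V *m const_mx 1 = const_mx 1 :> 'cV[R]_#|C|,
      V^T = V,
      spectral_radius
        (V - #|C|%:R^-1 *: (const_mx 1 *m (const_mx 1 : 'cV[R]_#|C|)^T))
        <= lambda
    & lambda < 1].

(** All the nodes live in one finite type and [layer] sorts them.
    [children k n] is only meaningful at iterations [k >= 1] and for nodes [n]
    of layer [< J]; the cluster below [n] is referred to through [n] itself. *)
Record network (J : nat) := Network {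
  node : finType;
  layer : node -> 'I_J.+1;
  server : node;
  children : nat -> node -> {set node};
  layer_set := fun j : nat => [set n : node | layer n == j :> nat];
  layer_set_neq0 : forall j : nat, (j <= J)%N -> layer_set j != finset.set0;
  layer_set0 : layer_set 0 = [set server]%SET;
  children_partition : forall k j : nat, (0 < k)%N -> (j < J)%N ->
    finset.partition [set children k n | n in layer_set j]%SET
                     (layer_set j.+1);
  children_inj : forall k j : nat, (0 < k)%N -> (j < J)%N ->
    {in layer_set j &, injective (children k)}
}.

Arguments layer {J} n _.
Arguments server {J} n.
Arguments children {J} n _ _.
Arguments layer_set {J} n _.

Section MHFL.

Variables (R : realType) (J M : nat) (net : network J).
Variables (dataset : node net -> finType) (f : node net -> 'rV[R]_M -> R).

Definition data_size : nat := (\sum_(n in layer_set net J) #|dataset n|)%N.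

Definition global_loss (x : 'rV[R]_M) : R :=
  data_size%:R^-1 * \sum_(n in layer_set net J) #|dataset n|%:R * f n x.

(** [A k] is the set of the nodes of layer [J - 1] whose child cluster is
    engaged at iteration [k]. *)
Variable A : nat -> {set node net}.

Definition engaged (k : nat) (i : node net) : bool :=
  [exists n in A k, i \in children net k n].

Definition child_rel (k : nat) : rel (node net) :=
  [rel a b | (layer net a < J)%N && (b \in children net k a)].

Definition active (k : nat) (n : node net) : bool :=
  [exists i, [&& engaged k i, connect (child_rel k) (server net) n
                            & connect (child_rel k) n i]].

(** Activity of the cluster [children net k n], for [n] of layer [< J]. *)
Definition active_cluster (k : nat) (n : node net) : bool :=
  if (layer net n).+1 == J then n \in A k
  else [exists i in children net k n, active k i].

Definition active_data_size (k : nat) : nat :=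
  (\sum_(i in layer_set net J | engaged k i) #|dataset i|)%N.

Variables (lut : nat -> node net -> bool) (theta : nat -> node net -> nat).
Variable V : forall (k : nat) (n : node net), 'M[R]_#|children net k n|.

Definition cluster_mx (wt : node net -> 'rV[R]_M) (C : {set node net}) :
    'M[R]_(#|C|, M) :=
  \matrix_(a < #|C|) wt (enum_val a).

(** [w] and [wt] are the models of a realization of the algorithm with step
    size [beta]: [w k] is the server model after iteration [k] and [wt k n] is
    the (scaled) vector held by node [n] during iteration [k].  The index [a] in
    the LUT clause is the sampled child, left arbitrary. *)
Record mhfl_run (beta : R) (w : nat -> 'rV[R]_M)
    (wt : nat -> node net -> 'rV[R]_M) : Prop := MhflRun {
  run_engaged : forall k : nat, (0 < k)%N ->
    A k != finset.set0 /\ A k \subset layer_set net J.-1;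
  run_device : forall (k : nat) (n : node net), (0 < k)%N ->
    n \in layer_set net J -> active k n ->
    wt k n = #|dataset n|%:R *: (w k.-1 - beta *: grad (f n) (w k.-1));
  run_passive : forall (k : nat) (n : node net), (0 < k)%N ->
    ~~ active k n -> wt k n = 0;
  run_EUT : forall (k : nat) (n : node net), (0 < k)%N ->
    (layer net n < J)%N -> active k n -> ~~ lut k n ->
    wt k n = \sum_(i in children net k n) wt k i;
  run_LUT : forall (k : nat) (n : node net), (0 < k)%N ->
    (layer net n < J)%N -> active k n -> lut k n ->
    exists a : 'I_#|children net k n|,
      wt k n = #|children net k n|%:R *:
        row a (V k n ^+ theta k n *m cluster_mx (wt k) (children net k n));
  run_server : forall k : nat, (0 < k)%N ->
    w k = (active_data_size k)%:R^-1 *: wt k (server net)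
}.

Definition Phi : nat := (\sum_(j < J) #|layer_set net j|)%N.

Definition Xi (lambda Upsilon : nat -> node net -> R) (t : nat) : R :=
  \sum_(j < J) \sum_(n in layer_set net j)
    (active_cluster t n && lut t n)%:R * #|children net t n|%:R ^+ 3
    * lambda t n ^+ (2 * theta t n) * Upsilon t n ^+ 2.

End MHFL.

(* Main.v *)
(** Within one iteration the models uploaded by a layer sum to the models
    uploaded by the layer below, up to one error vector per active LUT cluster.
    Since [V] and the averaging matrix [P] satisfy [V P = P V = P P = P], the
    deviation from the cluster average is multiplied by [V - P] at each round,
    and the spectral theorem bounds that symmetric matrix by its spectral radius.
    Hence the server performs the gradient step [x - (grad F x - r) / eta], where
    [r] consists of the sampling error (the full average of the local gradients
    minus the average over the engaged devices) and the accumulated consensus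
    error.  The descent lemma gives
    [F x' <= F x - |grad F x|^2 / (2 eta) + |r|^2 / (2 eta)], and
    [2 mu (F x - F x* ) <= |grad F x|^2 <= 2 eta (F x - F x* )] turns this into an
    affine recursion for the optimality gap. *)

Require Import Defs.
From mathcomp Require Import all_boot all_order all_algebra.
From mathcomp Require Import complex spectral.
From mathcomp Require Import boolp classical_sets functions reals topology normedtype derive.
From mathcomp Require Import ring lra.
Import Order.TTheory GRing.Theory Num.Theory numFieldNormedType.Exports.
Local Open Scope ring_scope.

Set Implicit Arguments.
Unset Strict Implicit.
Unset Printing Implicit Defensive.

(** * Euclidean geometry and gradients *)

Section Euclidean.
Context {R : realType} {M : nat}.
Implicit Types (u v x y d : 'rV[R]_M).

Definition dot u v : R := (u *m v^T) 0 0.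

Lemma dotE u v : dot u v = \sum_(i < M) u 0 i * v 0 i.
Proof. by rewrite /dot mxE; apply: eq_bigr => i _; rewrite !mxE. Qed.

Lemma dotC u v : dot u v = dot v u.
Proof. by rewrite !dotE; apply: eq_bigr => i _; rewrite mulrC. Qed.

Lemma dotDl u v x : dot (u + v) x = dot u x + dot v x.
Proof. by rewrite /dot mulmxDl mxE. Qed.

Lemma dotZl (a : R) u v : dot (a *: u) v = a * dot u v.
Proof. by rewrite /dot -scalemxAl mxE. Qed.

Lemma dotNl u v : dot (- u) v = - dot u v.
Proof. by rewrite /dot mulNmx mxE. Qed.

Lemma dotDr u v x : dot x (u + v) = dot x u + dot x v.
Proof. by rewrite dotC dotDl !(dotC x). Qed.

Lemma dotZr (a : R) u v : dot u (a *: v) = a * dot u v.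
Proof. by rewrite dotC dotZl dotC. Qed.

Lemma dotNr u v : dot u (- v) = - dot u v.
Proof. by rewrite dotC dotNl dotC. Qed.

Lemma dot_suml (I : Type) (r : seq I) (P : pred I) (u : I -> 'rV[R]_M) v :
  dot (\sum_(i <- r | P i) u i) v = \sum_(i <- r | P i) dot (u i) v.
Proof. by rewrite /dot mulmx_suml summxE. Qed.

Definition dot_lin := (dotDl, dotDr, dotNl, dotNr, dotZl, dotZr).

Lemma dot_ge0 u : 0 <= dot u u.
Proof. by rewrite dotE sumr_ge0 // => i _; rewrite -expr2 sqr_ge0. Qed.

Lemma enorm_sqr u : enorm u ^+ 2 = dot u u.
Proof.
rewrite /enorm sqr_sqrtr; last by apply: sumr_ge0 => i _; exact: sqr_ge0.
by rewrite dotE; apply: eq_bigr => i _; rewrite expr2.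
Qed.

Lemma enorm_ge0 u : 0 <= enorm u.
Proof. exact: sqrtr_ge0. Qed.

(** Expand the square of [u - c *: v] and divide by [c]. *)
Lemma dot_young (c : R) u v : 0 < c -> 2 * dot u v <= dot u u / c + c * dot v v.
Proof.
move=> c_gt0; have := dot_ge0 (u - c *: v).
rewrite !dot_lin (dotC v u) => h.
rewrite -(ler_pM2l c_gt0) mulrDr.
have -> : c * (dot u u / c) = dot u u by field; lra.
by nra.
Qed.

Lemma dot_add_le u v : dot (u + v) (u + v) <= 2 * dot u u + 2 * dot v v.
Proof. by have := dot_ge0 (u - v); rewrite !dot_lin (dotC v u); lra. Qed.

(** Jensen's inequality for the squared norm, in unnormalised form. Pairing each [u i] with the
    total vector [s] by Young's inequality and summing with the weights [a i] bounds [2 * dot s s]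
    by the right-hand side plus [dot s s]. *)
Lemma dot_sum_le (I : Type) (r : seq I) (P : pred I) (a : I -> R)
    (u : I -> 'rV[R]_M) :
  (forall i, P i -> 0 <= a i) ->
  dot (\sum_(i <- r | P i) a i *: u i) (\sum_(i <- r | P i) a i *: u i) <=
             (\sum_(i <- r | P i) a i) *
             \sum_(i <- r | P i) a i * dot (u i) (u i).
Proof.
move=> a_ge0; set s := \sum_(i <- r | P i) a i *: u i; set S := \sum_(i <- r | P i) a i.
have S_ge0 : 0 <= S by apply: sumr_ge0.
have [S0|S_neq0] := eqVneq S 0.
  (* Nonnegative weights with zero sum all vanish, so [s] vanishes too. *)
  suff -> : s = 0 by rewrite /dot mul0mx mxE S0 mul0r.
  rewrite /s; move: S0; rewrite /S; elim: r {s S S_ge0} => [|i r IHr].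
    by rewrite !big_nil.
  rewrite !big_cons; case: ifP => // Pi /eqP.
  rewrite paddr_eq0 ?a_ge0 ?sumr_ge0 // => /andP[/eqP -> /eqP S0].
  by rewrite scale0r add0r IHr.
have S_gt0 : 0 < S by rewrite lt_def S_neq0.
(* Young's parameter is [S^-1], so that the terms [dot s s / S] add up to exactly one [dot s s]. *)
have : \sum_(i <- r | P i) a i * (2 * dot (u i) s) <=
       \sum_(i <- r | P i) a i * (S * dot (u i) (u i) + dot s s / S).
  apply: ler_sum => i Pi; apply: ler_wpM2l; first exact: a_ge0.
  have := dot_young (c := S^-1) (u i) s; rewrite invr_gt0 invrK => /(_ S_gt0); lra.
have -> : \sum_(i <- r | P i) a i * (2 * dot (u i) s) = 2 * dot s s.
  rewrite {2}/s dot_suml mulr_sumr; apply: eq_bigr => i _.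
  by rewrite dotZl; ring.
have -> : \sum_(i <- r | P i) a i * (S * dot (u i) (u i) + dot s s / S) =
    S * (\sum_(i <- r | P i) a i * dot (u i) (u i)) + dot s s.
  under eq_bigr do rewrite mulrDr mulrCA.
  by rewrite big_split /= -mulr_sumr -mulr_suml -/S [S * (_ / S)]mulrCA divff // mulr1.
lra.
Qed.

End Euclidean.

(** * Consequences of smoothness and strong convexity *)

Section Descent.
Context {R : realType} {M : nat}.
Implicit Types (F : 'rV[R]_M -> R) (x y d : 'rV[R]_M).

Lemma derive_grad F x d : differentiable F x -> 'D_d F x = dot d (grad F x).
Proof.
move=> F_diff; rewrite deriveE // {1}(row_sum_delta d) linear_sum dotE.
by apply: eq_bigr => i _; rewrite linearZ /= !mxE deriveE.
Qed.

(** The difference quotient of the restriction to the line is the quotient of [F] at [x + t *: d] in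
    direction [d], so the directional derivative can be read off directly. *)
Lemma is_derive_line F x d (t : R) : differentiable F (x + t *: d) ->
  is_derive t (1 : R) (fun s => F (x + s *: d)) (dot d (grad F (x + t *: d))).
Proof.
move=> F_diff.
have quotE : (fun h : R => h^-1 *: (((fun s => F (x + s *: d)) \o shift t) (h *: 1)
      - F (x + t *: d))) =
    (fun h : R => h^-1 *: ((F \o shift (x + t *: d)) (h *: d) - F (x + t *: d))).
  apply/funext => h /=; congr (_ *: (F _ - _)).
  have -> : h *: (1 : R) = h by exact: mulr1.
  by rewrite scalerDl addrCA.
apply: DeriveDef; first by rewrite /derivable quotE; exact: diff_derivable.
by rewrite -derive_grad // /derive quotE.
Qed.

(** The mean value theorem replaces integration along the segment: [h] is [F] on the segment minus
    the linear and quadratic terms of the claimed bound, and its derivative is nonpositive on the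
    open interval. *)
Lemma descent_lemma (eta : R) F : 0 < eta -> (forall x, differentiable F x) ->
  smooth eta F ->
  forall x d, F (x + d) <= F x + dot d (grad F x) + eta / 2 * dot d d.
Proof.
move=> eta_gt0 F_diff F_smooth x d.
pose h t := F (x + t *: d) - t * dot d (grad F x) - eta / 2 * t ^+ 2 * dot d d.
have h_drv (t : R) : is_derive t (1 : R) h
    (dot d (grad F (x + t *: d)) - dot d (grad F x) - eta * t * dot d d).
  have h_eq : h = (fun s => F (x + s *: d)) - id * cst (dot d (grad F x))
      - cst (eta / 2 * dot d d) * (id * id).
    by apply/funext => s; rewrite /h !fctE; ring.
  rewrite h_eq; have line_drv := is_derive_line (F_diff (x + t *: d)).
  apply: is_derive_eq; rewrite !fctE /GRing.scale /=; set u := dot d _; lra.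
have h_cont : {within `[0, 1], continuous h}%classic.
  apply: derivable_within_continuous => t _.
  exact: ex_derive.
have [t /[!in_itv] /= /andP[t_gt0 _]] := MVT ltr01 (fun t _ => h_drv t) h_cont.
rewrite subr0 mulr1 /h scale1r scale0r addr0.
have := F_smooth (x + t *: d) x; rewrite [x + _ - x]addrC addKr.
set u := grad F _ - _ => hu.
have : dot u u <= (eta * t) ^+ 2 * dot d d.
  have -> : (eta * t) ^+ 2 * dot d d = eta ^+ 2 * dot (t *: d) (t *: d).
    by rewrite !dot_lin; ring.
  rewrite -!enorm_sqr -exprMn ler_pXn2r // nnegrE ?enorm_ge0 //.
  by rewrite mulr_ge0 ?enorm_ge0 ?ltW.
(* By smoothness [u] has norm at most [eta * t] times that of [d]. Young's inequality with parameter
   [eta * t] therefore gives [dot u d <= eta * t * dot d d], which is the sign of the derivative of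
   [h]. *)
have et_gt0 : 0 < eta * t by rewrite mulr_gt0.
have := dot_young u d et_gt0.
have -> : dot u d = dot d (grad F (x + t *: d)) - dot d (grad F x).
  by rewrite !dot_lin !(dotC d).
rewrite -[dot u u <= _](ler_pM2r (x := (eta * t)^-1)) ?invr_gt0 //.
have -> : (eta * t) ^+ 2 * dot d d / (eta * t) = eta * t * dot d d.
  by field; rewrite !gt_eqF.
rewrite expr0n expr1n /=; lra.
Qed.

(** The strong convexity lower bound is a quadratic in [y - x]; completing its square leaves only
    the squared gradient. *)
Lemma polyak_lojasiewicz (mu : R) F x y : 0 < mu -> strongly_convex mu F ->
  2 * mu * (F x - F y) <= dot (grad F x) (grad F x).
Proof.
move=> mu_gt0 /(_ x y); rewrite -/(dot _ _) enorm_sqr => sc.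
have := dot_ge0 (grad F x + mu *: (y - x)).
rewrite dotDl !dotDr !dotZl !dotZr (dotC (grad F x)) => h.
nra.
Qed.

(** A gradient step of length [1 / eta] from [x] lowers [F] by at least the squared gradient over
    [2 * eta], yet cannot go below the minimum [F y]. *)
Lemma grad_sqr_le (eta : R) F x y : 0 < eta ->
  (forall x, differentiable F x) -> smooth eta F -> (forall x, F y <= F x) ->
  dot (grad F x) (grad F x) <= 2 * eta * (F x - F y).
Proof.
move=> eta_gt0 F_diff F_smooth y_min.
have := descent_lemma eta_gt0 F_diff F_smooth x (- eta^-1 *: grad F x).
have := y_min (x + - eta^-1 *: grad F x).
rewrite !dotZl !dotZr; set q := dot _ _ => h1 h2.
have : eta * F y <= eta * (F x + - eta^-1 * q + eta / 2 * (- eta^-1 * (- eta^-1 * q))).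
  by rewrite ler_pM2l //; apply: le_trans h2.
have -> : eta * (F x + - eta^-1 * q + eta / 2 * (- eta^-1 * (- eta^-1 * q))) =
   eta * F x - q / 2 by field; lra.
lra.
Qed.

End Descent.

(** * Spectral bound for consensus *)

Section Normal.
Context {C : numClosedFieldType} {n : nat}.

Lemma sqnormE (y : 'rV[C]_n) :
  (y *m (y ^t* )%sesqui) 0 0 = \sum_i `|y 0 i| ^+ 2.
Proof. by rewrite mxE; apply: eq_bigr => i _; rewrite !mxE -normCK. Qed.

Lemma unitary_dotmx (U : 'M[C]_n) (y : 'rV[C]_n) : U \is unitarymx ->
  (y *m U) *m ((y *m U) ^t* )%sesqui = y *m (y ^t* )%sesqui.
Proof.
move=> /unitarymxP UU.
by rewrite trmx_mul map_mxM mulmxA -(mulmxA y) UU mulmx1.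
Qed.

(** The eigenvector is row [i] of the diagonalising matrix, nonzero because that matrix is
    invertible. *)
Lemma eigenvalue_spectral_diag (A : 'M[C]_n) i : A \is normalmx ->
  eigenvalue A (spectral_diag A 0 i).
Proof.
move=> A_normal; have spE := orthomx_spectralP A_normal.
have P_unit := spectral_unit A; move: spE P_unit.
set P := spectralmx A; set sp := spectral_diag A => spE P_unit.
apply/eigenvalueP; exists (row i P); last first.
  apply/eqP => Pi0; have := congr1 (fun B : 'M_n => row i B) (mulmxV P_unit).
  rewrite row_mul Pi0 mul0mx row1 => /rowP/(_ i)/eqP.
  by rewrite !mxE !eqxx eq_sym oner_eq0.
rewrite -row_mul [X in P *m X]spE mulmxA mulmxA mulmxV // mul1mx row_mul.
by rewrite row_diag_mx -scalemxAl -rowE.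
Qed.

(** In the coordinates [z] of an orthonormal eigenbasis, [A] multiplies each entry by an eigenvalue,
    and the unitary change of basis preserves the norm. *)
Lemma normal_contraction (A : 'M[C]_n) (lambda : C) (y : 'rV[C]_n) :
  A \is normalmx -> (forall a, eigenvalue A a -> `|a| <= lambda) ->
  let y' := y *m A in
  (y' *m (y' ^t* )%sesqui) 0 0 <= lambda ^+ 2 * (y *m (y ^t* )%sesqui) 0 0.
Proof.
move=> A_normal A_le; have spE := orthomx_spectralP A_normal.
have P_unit := spectral_unit A; have P_unitary := spectral_unitarymx A.
have sp_le i := A_le _ (eigenvalue_spectral_diag i A_normal).
move: spE P_unit P_unitary sp_le.
set P := spectralmx A; set sp := spectral_diag A => spE P_unit P_unitary sp_le.
pose z := y *m invmx P.
have yE : y = z *m P by rewrite mulmxKV.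
have yAE : y *m A = z *m diag_mx sp *m P by rewrite [in LHS]spE !mulmxA.
rewrite /= yAE [in leRHS]yE !(unitary_dotmx _ P_unitary) !sqnormE mulr_sumr.
apply: ler_sum => i _.
rewrite mul_mx_diag mxE normrM exprMn mulrC ler_wpM2r ?exprn_ge0 //.
by rewrite ler_pXn2r // nnegrE ?normr_ge0 // (le_trans _ (sp_le i)).
Qed.

End Normal.

Section Spectral.
Context {R : realType} {n : nat}.

(** A supremum is an upper bound only for a bounded set. The eigenvalues are roots of the
    characteristic polynomial, so the sum of the moduli of all its roots bounds each of them. *)
Lemma spectral_radius_ub (A : 'M[R]_n) (z : R[i]) :
  eigenvalue (map_mx (@real_complex R) A) z ->
  complex.Re `|z| <= spectral_radius A.
Proof.
move=> Az; apply: sup_upper_bound; last by exists z.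
split; first by exists (complex.Re `|z|); exists z.
have [r r_eq] := closed_field_poly_normal (char_poly (map_mx (@real_complex R) A)).
exists (\sum_(x <- r) complex.Re `|x|) => _ [x Ax <-].
move: Ax; rewrite /= eigenvalue_root_char r_eq (monicP (char_poly_monic _)) scale1r.
rewrite root_prod_XsubC => xr; rewrite (big_rem _ xr) /= lerDl.
by apply: sumr_ge0 => -[a b] _; exact: sqrtr_ge0.
Qed.

Lemma dot_complex (x : 'rV[R]_n) :
  let y := map_mx (@real_complex R) x in
  (y *m (y ^t* )%sesqui) 0 0 = (dot x x)%:C%C.
Proof.
rewrite /= mxE dotE rmorph_sum; apply: eq_bigr => i _; rewrite !mxE.
by apply/eqP; rewrite eq_complex /= oppr0 mulr0 mul0r subr0 addr0 mulr0 !eqxx.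
Qed.

(** Over the complex numbers a real symmetric matrix is Hermitian, hence normal, and a real vector
    keeps its squared norm. *)
Lemma symmetric_contraction (A : 'M[R]_n) (lambda : R) (x : 'rV[R]_n) :
  A^T = A -> spectral_radius A <= lambda ->
  dot (x *m A) (x *m A) <= lambda ^+ 2 * dot x x.
Proof.
move=> A_sym rho_le.
pose AC := map_mx (@real_complex R) A; pose xC := map_mx (@real_complex R) x.
have AC_normal : AC \is normalmx.
  apply: hermitian_normalmx; apply/is_hermitianmxP; rewrite expr0 scale1r.
  apply/matrixP => i j; rewrite !mxE -{1}A_sym !mxE /=.
  by apply/eqP; rewrite eq_complex /= oppr0 !eqxx.
rewrite -lecR.
have -> : (lambda ^+ 2 * dot x x)%:C%C =
    lambda%:C%C ^+ 2 * (xC *m (xC ^t* )%sesqui) 0 0.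
  by rewrite dot_complex rmorphM rmorphXn.
rewrite -(dot_complex (x *m A)) map_mxM.
have := normal_contraction (lambda := lambda%:C%C) xC AC_normal.
apply=> z /spectral_radius_ub h.
by rewrite normc_def lecR; apply: le_trans rho_le; rewrite normc_def in h.
Qed.

End Spectral.

(** * Contraction of the deviation from the cluster average *)

Section Consensus.
Context {R : realType} {n M : nat}.
Implicit Types (V : 'M[R]_n) (W : 'M[R]_(n, M)).

(** Written as in [consensus_matrix], so that the spectral hypothesis there applies by
    conversion. *)
Definition avg_mx : 'M[R]_n :=
  n%:R^-1 *: (const_mx 1 *m (const_mx 1 : 'cV[R]_n)^T).

Definition frob_sqr W : R := \sum_a dot (row a W) (row a W).

(** Errors are read off row by row, whereas a consensus round acts on each column separately; this
    passes from one view to the other. *)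
Lemma frob_sqr_cols W : frob_sqr W = \sum_j dot (col j W)^T (col j W)^T.
Proof.
rewrite /frob_sqr; under eq_bigr do rewrite dotE.
rewrite exchange_big /=; apply: eq_bigr => j _; rewrite dotE.
by apply: eq_bigr => i _; rewrite !mxE.
Qed.

Lemma row_sqr_le_frob W a : dot (row a W) (row a W) <= frob_sqr W.
Proof.
by rewrite /frob_sqr (bigD1 a) //= lerDl sumr_ge0 // => i _; exact: dot_ge0.
Qed.

Lemma frob_sqr_mul_le V (lambda : R) W : V^T = V ->
  spectral_radius V <= lambda -> frob_sqr (V *m W) <= lambda ^+ 2 * frob_sqr W.
Proof.
move=> V_sym V_le; rewrite !frob_sqr_cols mulr_sumr; apply: ler_sum => j _.
have -> : (col j (V *m W))^T = (col j W)^T *m V.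
  by rewrite -{2}V_sym -trmx_mul !colE mulmxA.
exact: symmetric_contraction.
Qed.

Lemma avg_mx_sym : avg_mx^T = avg_mx.
Proof. by rewrite /avg_mx linearZ /= trmx_mul trmxK. Qed.

Lemma mul_const_avg V : V *m const_mx 1 = const_mx 1 :> 'cV[R]_n ->
  V *m avg_mx = avg_mx.
Proof. by move=> V1; rewrite /avg_mx -scalemxAr mulmxA V1. Qed.

Lemma avg_mx_const : (0 < n)%N ->
  avg_mx *m const_mx 1 = const_mx 1 :> 'cV[R]_n.
Proof.
move=> n_gt0; apply/matrixP => i j.
rewrite /avg_mx -scalemxAl -mulmxA !mxE big_ord1 !mxE mul1r.
under eq_bigr do rewrite !mxE mul1r.
by rewrite sumr_const card_ord mulVf // pnatr_eq0 -lt0n.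
Qed.

(** Since [V] and [avg_mx] absorb each other into [avg_mx], one more round turns the deviation [Y]
    into [(V - avg_mx) *m Y], and each round costs one factor [lambda ^+ 2]. *)
Lemma consensus_error V (lambda : R) (t : nat) W : (0 < n)%N ->
  V *m const_mx 1 = const_mx 1 :> 'cV[R]_n -> V^T = V ->
  spectral_radius (V - avg_mx) <= lambda ->
  frob_sqr (V ^+ t *m W - avg_mx *m W) <=
    lambda ^+ (2 * t) * frob_sqr (W - avg_mx *m W).
Proof.
move=> n_gt0 V1 V_sym rho_le.
have VP : V *m avg_mx = avg_mx := mul_const_avg V1.
have PP : avg_mx *m avg_mx = avg_mx := mul_const_avg (avg_mx_const n_gt0).
have PV : avg_mx *m V = avg_mx.
  by rewrite -{1}avg_mx_sym -{1}V_sym -trmx_mul VP avg_mx_sym.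
have PVt s : avg_mx *m V ^+ s = avg_mx.
  by elim: s => [|s IHs]; rewrite ?expr0 ?mulmx1 // exprSr mulmxA IHs.
elim: t => [|t IHt]; first by rewrite muln0 !expr0 mul1mx mul1r.
set Y := V ^+ t *m W - avg_mx *m W in IHt.
have -> : V ^+ t.+1 *m W - avg_mx *m W = (V - avg_mx) *m Y.
  rewrite /Y mulmxBl !mulmxBr !mulmxA PVt VP PP subrr subr0.
  by rewrite exprS.
rewrite mulnS exprD -mulrA; apply: le_trans (ler_wpM2l (sqr_ge0 _) IHt).
apply: frob_sqr_mul_le => //.
by rewrite linearB /= V_sym avg_mx_sym.
Qed.

(** Each row's deviation from the average is the average of its differences with all the rows, so
    Jensen's inequality bounds it by [c]; there are [n] rows. *)
Lemma frob_sqr_dispersion (c : R) W : (0 < n)%N ->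
  (forall a b, dot (row a W - row b W) (row a W - row b W) <= c) ->
  frob_sqr (W - avg_mx *m W) <= n%:R * c.
Proof.
move=> n_gt0 W_le.
have n_neq0 : n%:R != 0 :> R by rewrite pnatr_eq0 -lt0n.
have -> : n%:R * c = \sum_(a < n) c by rewrite sumr_const card_ord mulr_natl.
apply: ler_sum => a _.
have -> : row a (W - avg_mx *m W) =
    \sum_(b < n) n%:R^-1 *: (row a W - row b W).
  apply/rowP => j; rewrite -scaler_sumr sumrB sumr_const card_ord !mxE summxE.
  rewrite mulrBr mulmxnE mxE -[W a j *+ n]mulr_natl mulKf //; congr (_ - _).
  rewrite mulr_sumr; apply: eq_bigr => b _.
  by rewrite !mxE big_ord1 !mxE !mulr1.
apply: (le_trans (dot_sum_le _ _ _)); first by move=> b _; rewrite invr_ge0.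
rewrite sumr_const card_ord -[_ *+ n]mulr_natl mulfV // mul1r.
apply: (@le_trans _ _ (\sum_(b < n) n%:R^-1 * c)).
  by apply: ler_sum => b _; rewrite ler_wpM2l ?invr_ge0.
by rewrite sumr_const card_ord -[_ *+ n]mulr_natl mulrA mulfV // mul1r.
Qed.

End Consensus.

(** * Activity in the network *)

Section Network.
Context {J : nat} (net : network J) (k : nat) (k_gt0 : (0 < k)%N).
Local Notation ch := (children net k).
Local Notation L := (layer_set net).

Lemma in_layer j (n : node net) : (n \in L j) = (layer net n == j :> nat).
Proof. by rewrite inE. Qed.

Lemma child_layer (n i : node net) : (layer net n < J)%N -> i \in ch n ->
  layer net i = (layer net n).+1 :> nat.
Proof.
move=> nJ i_n; have /and3P[/eqP cov _ _] := children_partition net k_gt0 nJ.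
have : i \in finset.cover [set ch m | m in L (layer net n)]%SET.
  apply/bigcupP; exists (ch n) => //.
  by apply: imset_f; rewrite in_layer.
by rewrite cov in_layer => /eqP.
Qed.

Lemma exists_parent (i : node net) j : (j < J)%N -> layer net i = j.+1 :> nat ->
  exists2 n, n \in L j & i \in ch n.
Proof.
move=> jJ i_j; have /and3P[/eqP cov _ _] := children_partition net k_gt0 jJ.
have : i \in finset.cover [set ch m | m in L j]%SET by rewrite cov in_layer i_j.
by move=> /bigcupP[_ /imsetP[n n_j ->] i_n]; exists n.
Qed.

(** The layer of the child fixes that of both parents; within one layer the child sets are disjoint
    and [children] is injective. *)
Lemma parent_unique (i n m : node net) : (layer net n < J)%N ->
  (layer net m < J)%N -> i \in ch n -> i \in ch m -> n = m.
Proof.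
move=> nJ mJ i_n i_m.
have nm : layer net n = layer net m :> nat.
  by apply: succn_inj; rewrite -(child_layer nJ i_n) -(child_layer mJ i_m).
have /and3P[_ /finset.trivIsetP triv _] := children_partition net k_gt0 nJ.
have n_in : n \in L (layer net n) by rewrite in_layer.
have m_in : m \in L (layer net n) by rewrite in_layer nm.
apply: (children_inj k_gt0 nJ) => //; apply/eqP/negP => /negP neq.
have := triv _ _ (imset_f _ n_in) (imset_f _ m_in) neq.
by move=> /pred0P/(_ i); rewrite /= i_n i_m.
Qed.

Lemma children_neq0 (n : node net) : (layer net n < J)%N ->
  (0 < #|ch n|)%N.
Proof.
move=> nJ; have /and3P[_ _ P0] := children_partition net k_gt0 nJ.
rewrite card_gt0; apply: contraNneq P0 => <-; apply: imset_f.
by rewrite in_layer.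
Qed.

Lemma sum_children (T : nmodType) (F : node net -> T) j : (j < J)%N ->
  \sum_(i in L j.+1) F i = \sum_(n in L j) \sum_(i in ch n) F i.
Proof.
move=> jJ; rewrite (set_partition_big _ (children_partition net k_gt0 jJ)) /=.
by rewrite big_imset //; exact: children_inj.
Qed.

(** Induction on the layer, passing from a node to its parent. The path from the server required by
    [active] thus always exists, which yields the simpler criterion [activeP]. *)
Lemma server_connect (i : node net) :
  connect (child_rel k) (server net) i.
Proof.
have [j] := ubnP (layer net i); elim: j i => // j IHj i i_j.
case E : (nat_of_ord (layer net i)) => [|l].
  have : i \in L 0 by rewrite in_layer E.
  by rewrite layer_set0 inE => /eqP ->.
have lJ : (l < J)%N by rewrite -ltnS -E.
have [n /[!in_layer] /eqP n_l i_n] := exists_parent lJ E.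
apply: (connect_trans (IHj n _)); first by rewrite n_l; rewrite E in i_j.
by apply: connect1; rewrite /child_rel /= n_l lJ.
Qed.

Lemma connect_first (n i : node net) : connect (child_rel k) n i -> n != i ->
  (layer net n < J)%N /\ exists2 m, m \in ch n & connect (child_rel k) m i.
Proof.
case/connectP => -[|m p] /=; first by move=> _ ->; rewrite eqxx.
move=> /andP[/andP[nJ m_n] mp] -> _; split => //.
by exists m => //; apply/connectP; exists p.
Qed.

Section Active.
Variables (A : nat -> {set node net}) (J_gt0 : (0 < J)%N).
Hypothesis A_sub : A k \subset L J.-1.

Lemma layer_engaged (n : node net) : n \in A k -> layer net n = J.-1 :> nat.
Proof. by move=> /(fintype.subsetP A_sub); rewrite in_layer => /eqP. Qed.

Lemma engaged_layer (i : node net) : engaged A k i -> layer net i = J :> nat.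
Proof.
move=> /existsP[n /andP[/layer_engaged n_J i_n]].
by rewrite (child_layer _ i_n) n_J ?prednK.
Qed.

Lemma activeP (n : node net) : reflect
  (exists2 i, engaged A k i & connect (child_rel k) n i) (active A k n).
Proof.
apply: (iffP existsP) => [[i /and3P[? _ ?]]|[i ? ?]]; exists i => //.
by apply/and3P; split=> //; exact: server_connect.
Qed.

(** No edge of [child_rel] leaves an end device, so the only path from it is the trivial one. *)
Lemma active_device (i : node net) : i \in L J -> active A k i = engaged A k i.
Proof.
move=> /[!in_layer] /eqP iJ; apply/activeP/idP => [[i' ei' ii']|ei].
  have [-> //|/(connect_first ii')[]] := eqVneq i i'.
  by rewrite iJ ltnn.
by exists i.
Qed.

Lemma active_parent (n i : node net) : (layer net n < J)%N -> i \in ch n ->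
  active A k i -> active A k n.
Proof.
move=> nJ i_n /activeP[i' ei' ii']; apply/activeP; exists i' => //.
by apply: connect_trans ii'; apply: connect1; rewrite /child_rel /= nJ.
Qed.

(** The path from [n] to an engaged device passes through a child [m]. Above the bottom, [m] is an
    active child; at the bottom, [m] is the engaged device itself and its unique parent [n] must lie
    in [A k]. *)
Lemma active_active_cluster (n : node net) : (layer net n < J)%N ->
  active A k n -> active_cluster A k n.
Proof.
move=> nJ /activeP[i ei ni]; have iJ := engaged_layer ei.
have [ni_eq|/(connect_first ni)[_ [m m_n mi]]] := eqVneq n i.
  by rewrite ni_eq iJ ltnn in nJ.
rewrite /active_cluster; case: eqP => nJ1; last first.
  by apply/existsP; exists m; rewrite m_n; apply/activeP; exists i.
have mJ : layer net m = J :> nat by rewrite (child_layer nJ m_n).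
have [mi_eq|/(connect_first mi)[]] := eqVneq m i; last by rewrite mJ ltnn.
move: ei => /existsP[n' /andP[n'A i_n']].
rewrite (@parent_unique i n n') // -?mi_eq //.
by rewrite (layer_engaged n'A) prednK.
Qed.

Lemma exists_engaged : A k != finset.set0 -> exists i, engaged A k i.
Proof.
case/set0Pn => n nA; have nJ : (layer net n < J)%N.
  by rewrite (layer_engaged nA) prednK.
have /card_gt0P[i i_n] := children_neq0 nJ.
by exists i; apply/existsP; exists n; rewrite nA.
Qed.

End Active.
End Network.

(** * One iteration *)

Section Averages.
Context {R : realType} {M : nat}.

(** The vectors outside [Q] enter with weight [S^-1], those in [Q] only through the change of
    normalisation from [S^-1] to [Ss^-1]. With [Sp] the weight outside [Q], both parts have squared
    norm at most [(Sp / S) ^+ 2 * B], and adding them gives the factor 4. *)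
Lemma weighted_avg_diff_le (I : finType) (P Q : pred I) (a : I -> R)
    (v : I -> 'rV[R]_M) (B : R) :
  (forall i, P i -> 0 <= a i) -> (forall i, P i -> dot (v i) (v i) <= B) ->
  let S := \sum_(i | P i) a i in
  let Ss := \sum_(i | P i && Q i) a i in
  0 < Ss ->
  let d := S^-1 *: (\sum_(i | P i) a i *: v i)
           - Ss^-1 *: (\sum_(i | P i && Q i) a i *: v i) in
  dot d d <= 4 * ((S - Ss) / S) ^+ 2 * B.
Proof.
move=> a_ge0 v_le S Ss Ss_gt0.
have bound (p : pred I) : (forall i, p i -> P i) ->
    let s := \sum_(i | p i) a i *: v i in
    dot s s <= (\sum_(i | p i) a i) ^+ 2 * B.
  move=> pP; have ap_ge0 i : p i -> 0 <= a i by move=> /pP; exact: a_ge0.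
  apply: (le_trans (dot_sum_le _ _ ap_ge0)).
  rewrite expr2 -mulrA ler_wpM2l ?sumr_ge0 // mulr_suml; apply: ler_sum => i pi.
  by rewrite ler_wpM2l ?ap_ge0 ?v_le ?pP.
have SE : S = Ss + \sum_(i | P i && ~~ Q i) a i by rewrite /S (bigID Q).
have sumE : \sum_(i | P i) a i *: v i = \sum_(i | P i && Q i) a i *: v i +
    \sum_(i | P i && ~~ Q i) a i *: v i by rewrite (bigID Q).
have /= := bound _ (fun i (h : P i && Q i) => proj1 (andP h)).
have /= := bound _ (fun i (h : P i && ~~ Q i) => proj1 (andP h)).
move: SE sumE; rewrite -/Ss.
have : 0 <= \sum_(i | P i && ~~ Q i) a i.
  by apply: sumr_ge0 => i /andP[/a_ge0].
set Sp := \sum_(i | P i && ~~ Q i) a i => Sp_ge0 SE ->.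
set s := \sum_(i | P i && Q i) _; set u := \sum_(i | P i && ~~ Q i) _ => u_le s_le.
have S_gt0 : 0 < S by rewrite SE; lra.
have -> : S^-1 *: (s + u) - Ss^-1 *: s = S^-1 *: u + (S^-1 - Ss^-1) *: s.
  by rewrite scalerDr scalerBl addrAC addrC.
apply: (le_trans (dot_add_le _ _)); rewrite !dotZl !dotZr.
have h1 : S^-1 * (S^-1 * dot u u) <= (Sp / S) ^+ 2 * B.
  rewrite mulrA -expr2 exprMn exprVn mulrAC [leRHS]mulrC ler_wpM2l //.
  by rewrite invr_ge0 sqr_ge0.
have h2 : (S^-1 - Ss^-1) * ((S^-1 - Ss^-1) * dot s s) <= (Sp / S) ^+ 2 * B.
  have -> : S^-1 - Ss^-1 = - (Sp / (S * Ss)).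
    by rewrite SE; field; rewrite -SE !gt_eqF.
  rewrite mulrA -expr2 sqrrN.
  have -> : (Sp / S) ^+ 2 * B = (Sp / (S * Ss)) ^+ 2 * (Ss ^+ 2 * B).
    by field; rewrite !gt_eqF.
  by rewrite ler_wpM2l ?sqr_ge0.
have -> : S - Ss = Sp by rewrite SE addrC addKr.
lra.
Qed.

End Averages.

(** * Gradients of linear combinations *)

Section Gradient.
Context {R : realType} {M : nat}.

Lemma differentiable_lincomb (I : Type) (r : seq I) (P : pred I) (a : I -> R)
    (f : I -> 'rV[R]_M -> R) x :
  (forall i, P i -> differentiable (f i) x) ->
  differentiable (fun y => \sum_(i <- r | P i) a i * f i y) x.
Proof.
move=> f_diff; elim: r => [|i r IHr].
  rewrite (_ : (fun y => _) = cst 0); first exact: differentiable_cst.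
  by apply/funext => y; rewrite big_nil.
case Pi : (P i); last first.
  rewrite (_ : (fun y => _) = (fun y => \sum_(j <- r | P j) a j * f j y)) //.
  by apply/funext => y; rewrite big_cons Pi.
rewrite (_ : (fun y => _) =
  (a i *: f i) + (fun y => \sum_(j <- r | P j) a j * f j y)).
  by apply: differentiableD IHr; apply: differentiableZ; exact: f_diff.
by apply/funext => y; rewrite big_cons Pi !fctE.
Qed.

Lemma grad_lincomb (I : Type) (r : seq I) (P : pred I) (a : I -> R)
    (f : I -> 'rV[R]_M -> R) x :
  (forall i, P i -> differentiable (f i) x) ->
  grad (fun y => \sum_(i <- r | P i) a i * f i y) x =
  \sum_(i <- r | P i) a i *: grad (f i) x.
Proof.
move=> f_diff; apply/rowP => l; rewrite summxE mxE.
elim: r => [|i r IHr].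
  rewrite big_nil (_ : (fun y => _) = cst 0); first exact: derive_cst.
  by apply/funext => y; rewrite big_nil.
rewrite big_cons; case: ifP => Pi; last first.
  rewrite -IHr (_ : (fun y => _) = (fun y => \sum_(j <- r | P j) a j * f j y)) //.
  by apply/funext => y; rewrite big_cons Pi.
rewrite (_ : (fun y => _) =
  (a i *: f i) + (fun y => \sum_(j <- r | P j) a j * f j y)); last first.
  by apply/funext => y; rewrite big_cons Pi !fctE.
rewrite deriveD; last exact/diff_derivable/differentiable_lincomb.
  by rewrite deriveZ ?IHr ?mxE //; exact/diff_derivable/f_diff.
by apply/diff_derivable/differentiableZ; exact: f_diff.
Qed.

End Gradient.

(** * Progress of one perturbed gradient step *)

Section Step.
Context {R : realType} {M : nat}.

(** With step length [1 / eta] the cross terms between [grad F x] and [r] in the descent lemma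
    cancel exactly. *)
Lemma inexact_gradient_step (eta : R) (F : 'rV[R]_M -> R) x r : 0 < eta ->
  (forall x, differentiable F x) -> smooth eta F ->
  F (x - eta^-1 *: (grad F x - r)) <=
    F x - dot (grad F x) (grad F x) / (2 * eta) + dot r r / (2 * eta).
Proof.
move=> eta_gt0 F_diff F_smooth.
apply: (le_trans (descent_lemma eta_gt0 F_diff F_smooth x _)).
rewrite !dot_lin (dotC r (grad F x)) le_eqVlt; apply/orP; left; apply/eqP.
by field; rewrite gt_eqF.
Qed.

(** Here [q] stands for the fraction of data not engaged and [K] for the scaled consensus error. The
    descent term yields the factor [1 - mu / eta]; the part of the error proportional to the squared
    gradient is turned back into optimality gap by [grad_sqr_le], whence [8 * c2 * q ^+ 2]. *)
Lemma inexact_step_contraction (mu eta c1 c2 q K : R) (F : 'rV[R]_M -> R) x r y :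
  0 < mu -> 0 < eta -> 0 <= c2 ->
  (forall x, differentiable F x) -> strongly_convex mu F -> smooth eta F ->
  (forall x, F y <= F x) ->
  dot r r <= 2 * eta ^+ 2 * K
             + 8 * q ^+ 2 * (c1 + c2 * dot (grad F x) (grad F x)) ->
  F (x - eta^-1 *: (grad F x - r)) - F y <=
    (1 - mu / eta + 8 * c2 * q ^+ 2) * (F x - F y)
    + (eta * K + 4 / eta * q ^+ 2 * c1).
Proof.
move=> mu_gt0 eta_gt0 c2_ge0 F_diff F_sc F_smooth y_min r_le.
have step := inexact_gradient_step x r eta_gt0 F_diff F_smooth.
have PL := polyak_lojasiewicz x y mu_gt0 F_sc.
have up := grad_sqr_le x eta_gt0 F_diff F_smooth y_min.
move: step PL up r_le; set g := dot (grad F x) _; set D := F x - F y.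
set x' := x - _ => step PL up r_le.
have inv_ge0 : 0 <= (2 * eta)^-1 by rewrite invr_ge0; lra.
have PL' : mu / eta * D <= g / (2 * eta).
  have -> : mu / eta * D = (2 * mu * D) / (2 * eta) by field; rewrite gt_eqF.
  by rewrite ler_wpM2r.
have r_le' : dot r r / (2 * eta) <= eta * K + 4 / eta * q ^+ 2 * c1
    + 4 / eta * q ^+ 2 * c2 * g.
  have -> : eta * K + 4 / eta * q ^+ 2 * c1 + 4 / eta * q ^+ 2 * c2 * g =
    (2 * eta ^+ 2 * K + 8 * q ^+ 2 * (c1 + c2 * g)) / (2 * eta).
    by field; rewrite gt_eqF.
  by rewrite ler_wpM2r.
have up' : 4 / eta * q ^+ 2 * c2 * g <= 8 * c2 * q ^+ 2 * D.
  have -> : 8 * c2 * q ^+ 2 * D = 4 / eta * q ^+ 2 * c2 * (2 * eta * D).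
    by field; rewrite gt_eqF.
  rewrite ler_wpM2l // mulr_ge0 // mulr_ge0 ?sqr_ge0 // divr_ge0 //; lra.
have DE : F x - F y = D by [].
lra.
Qed.

End Step.

(** * Consensus error of one cluster *)

Section Cluster.
Context {R : realType} {M : nat}.

(** [#|C|] times any row of the averaged matrix is the sum over the cluster, so [e] is [#|C|] times
    a row of the consensus deviation. Scaling contributes [#|C| ^ 2] and the dispersion bound one
    more factor. The sampled row is arbitrary because the Frobenius norm dominates every row. *)
Lemma lut_error (J : nat) (net : network J) (C : {set node net})
    (G : rel (node net)) (lambda U : R)
    (V : 'M[R]_#|C|) (t : nat) (wt : node net -> 'rV[R]_M)
    (a : 'I_#|C|) :
  consensus_matrix G lambda V ->
  (forall q q', q \in C -> q' \in C -> enorm (wt q - wt q') <= U) ->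
  let e := #|C|%:R *: row a (V ^+ t *m cluster_mx wt C) - \sum_(i in C) wt i in
  dot e e <= #|C|%:R ^+ 3 * lambda ^+ (2 * t) * U ^+ 2.
Proof.
case=> _ V1 V_sym rho_le _ wt_le.
have C_gt0 : (0 < #|C|)%N by apply: leq_ltn_trans (ltn_ord a).
set W := cluster_mx wt C.
have C_neq0 : #|C|%:R != 0 :> R by rewrite pnatr_eq0 -lt0n.
have -> : #|C|%:R *: row a (V ^+ t *m W) - \sum_(i in C) wt i =
    #|C|%:R *: row a (V ^+ t *m W - avg_mx *m W).
  rewrite linearB /= scalerBr; congr (_ - _).
  apply/rowP => j; rewrite /avg_mx big_enum_val /= -scalemxAl -mulmxA !mxE mulrA.
  rewrite mulfV // mul1r big_ord1 !mxE mul1r summxE; apply: eq_bigr => i _.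
  by rewrite !mxE mul1r.
rewrite /= dotZl dotZr.
have row_le : dot (row a (V ^+ t *m W - avg_mx *m W))
    (row a (V ^+ t *m W - avg_mx *m W)) <= lambda ^+ (2 * t) * (#|C|%:R * U ^+ 2).
  apply: (le_trans (row_sqr_le_frob _ a)).
  apply: (le_trans (consensus_error t W C_gt0 V1 V_sym rho_le)).
  apply: ler_wpM2l; first by rewrite exprM exprn_ge0 ?sqr_ge0.
  apply: frob_sqr_dispersion => // b c; rewrite -enorm_sqr.
  have -> : row b W - row c W = wt (enum_val b) - wt (enum_val c).
    by apply/rowP => j; rewrite !mxE.
  have U_ge := wt_le _ _ (enum_valP b) (enum_valP c).
  (* [U] is nonnegative because it bounds a norm, so the bound may be squared. *)
  by rewrite ler_pXn2r // nnegrE ?enorm_ge0 // (le_trans (enorm_ge0 _) U_ge).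
have -> : #|C|%:R ^+ 3 * lambda ^+ (2 * t) * U ^+ 2 =
    #|C|%:R * (#|C|%:R * (lambda ^+ (2 * t) * (#|C|%:R * U ^+ 2))) by ring.
by rewrite !ler_wpM2l.
Qed.

End Cluster.

(** * Accumulated consensus error over all layers *)

Section Run.
Context {R : realType} {J M : nat} {net : network J}.
Variables (J_gt0 : (0 < J)%N) (dataset : node net -> finType).
Variables (f : node net -> 'rV[R]_M -> R).
Variables (lut : nat -> node net -> bool) (G : nat -> node net -> rel (node net)).
Variables (theta : nat -> node net -> nat) (lambda : nat -> node net -> R).
Variable V : forall (k : nat) (n : node net), 'M[R]_#|children net k n|.
Variables (beta : R) (A : nat -> {set node net}).
Variables (w : nat -> 'rV[R]_M) (wt : nat -> node net -> 'rV[R]_M).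
Variable Upsilon : nat -> node net -> R.
Hypothesis V_consensus : forall k n, (0 < k)%N -> (layer net n < J)%N ->
  lut k n -> consensus_matrix (G k n) (lambda k n) (V k n).
Hypothesis run : mhfl_run dataset f A lut theta V beta w wt.
Hypothesis divergence : forall k n, (0 < k)%N -> (layer net n < J)%N ->
  forall q q', q \in children net k n -> q' \in children net k n ->
  enorm (wt k q - wt k q') <= Upsilon k n.
Variables (k : nat) (k_gt0 : (0 < k)%N).

Let A_sub : A k \subset layer_set net J.-1 := (run_engaged run k_gt0).2.

Let err (n : node net) := wt k n - \sum_(i in children net k n) wt k i.
Let bound (n : node net) : R :=
  (active_cluster A k n && lut k n)%:R * #|children net k n|%:R ^+ 3
  * lambda k n ^+ (2 * theta k n) * Upsilon k n ^+ 2.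

(** Only active LUT nodes make an error: a passive node has only passive children, so all vectors
    involved are zero, and EUT aggregation is exact. *)
Lemma err_le (n : node net) : (layer net n < J)%N ->
  dot (err n) (err n) <= bound n.
Proof.
move=> nJ; have bound_ge0 : 0 <= bound n.
  rewrite /bound exprM; apply: mulr_ge0; last exact: sqr_ge0.
  apply: mulr_ge0; last exact/exprn_ge0/sqr_ge0.
  by apply: mulr_ge0 => //; exact: exprn_ge0.
have [n_act|n_pas] := boolP (active A k n); last first.
  suff -> : err n = 0 by rewrite /dot mul0mx mxE.
  rewrite /err (run_passive run k_gt0 n_pas) big1 ?subr0 // => i i_n.
  apply: (run_passive run k_gt0); apply: contra n_pas.
  exact: active_parent.
have [n_lut|n_eut] := boolP (lut k n); last first.
  suff -> : err n = 0 by rewrite /dot mul0mx mxE.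
  by rewrite /err (run_EUT run k_gt0 nJ n_act n_eut) subrr.
have [a wtE] := run_LUT run k_gt0 nJ n_act n_lut.
rewrite /err wtE /bound n_lut (active_active_cluster k_gt0 J_gt0 A_sub nJ n_act).
rewrite mul1r.
exact: lut_error (V_consensus k_gt0 nJ n_lut) (divergence k_gt0 nJ).
Qed.

(** Summing the definition of [err] over a layer replaces that layer by the next, because the child
    sets partition the next layer. *)
Lemma telescope_layers j : (j <= J)%N ->
  \sum_(n in layer_set net 0) wt k n =
  \sum_(n in layer_set net j) wt k n
  + \sum_(l < j) \sum_(n in layer_set net l) err n.
Proof.
elim: j => [|j IHj] jJ; first by rewrite big_ord0 addr0.
rewrite IHj ?(ltnW jJ) // (sum_children k_gt0) // big_ord_recr /=.
rewrite [\sum_(l < j) _ + _]addrC addrA; congr (_ + _).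
by rewrite -big_split /=; apply: eq_bigr => n _; rewrite /err addrC subrK.
Qed.

Lemma aggregate_error :
  let e := wt k (server net) -
           \sum_(i in layer_set net J | engaged A k i) wt k i in
  dot e e <= (Phi net)%:R * Xi A lut theta lambda Upsilon k.
Proof.
have := telescope_layers (leqnn J); rewrite layer_set0 big_set1 => -> /=.
(* End devices that are not engaged are passive and hold the zero vector. *)
rewrite (bigID (engaged A k)) /= [X in _ + X + _ - _]big1; last first.
  move=> i /andP[iJ i_pas].
  by apply: (run_passive run k_gt0); rewrite (active_device k_gt0).
rewrite addr0 addrC addKr.
(* One sum over all (layer, node) pairs, whose number is [Phi], so that Jensen's
   inequality costs a single factor [Phi]. *)
rewrite pair_big_dep /=.
have -> : \sum_(p : 'I_J * node net | p.2 \in layer_set net p.1) err p.2 =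
   \sum_(p : 'I_J * node net | p.2 \in layer_set net p.1) (1 : R) *: err p.2.
  by apply: eq_bigr => p _; rewrite scale1r.
apply: (le_trans (dot_sum_le _ _ _)) => //.
have -> : \sum_(p : 'I_J * node net | p.2 \in layer_set net p.1) (1 : R) =
    (Phi net)%:R.
  rewrite -(pair_big_dep xpredT (fun (j : 'I_J) n => n \in layer_set net j)
    (fun _ _ => 1)) /= /Phi natr_sum; apply: eq_bigr => j _.
  by rewrite sumr_const.
rewrite /Xi pair_big_dep /= ler_wpM2l //; apply: ler_sum => -[j n] /= n_j.
rewrite mul1r; apply: err_le; move: n_j; rewrite in_layer => /eqP ->.
exact: ltn_ord.
Qed.

End Run.

(** Unrolling by induction; nonnegative rates allow multiplying the induction hypothesis by
    [rate k.+1]. The new summand [b k.+1] carries an empty product. *)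
Lemma affine_recursion (R : realFieldType) (a rate b : nat -> R) :
  (forall k, 0 <= rate k) ->
  (forall k, a k.+1 <= rate k.+1 * a k + b k.+1) ->
  forall k, a k <= (\prod_(1 <= l < k.+1) rate l) * a 0%N
    + \sum_(1 <= t < k.+1) (\prod_(t.+1 <= l < k.+1) rate l) * b t.
Proof.
move=> rate_ge0 step; elim=> [|k IHk]; first by rewrite !big_geq // mul1r addr0.
apply: (le_trans (step k)).
have prodS t : (t <= k)%N -> \prod_(t.+1 <= l < k.+2) rate l =
    rate k.+1 * \prod_(t.+1 <= l < k.+1) rate l.
  by move=> tk; rewrite big_nat_recr // mulrC.
have -> : \sum_(1 <= t < k.+2) (\prod_(t.+1 <= l < k.+2) rate l) * b t =
    rate k.+1 * (\sum_(1 <= t < k.+1) (\prod_(t.+1 <= l < k.+1) rate l) * b t)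
    + b k.+1.
  rewrite big_nat_recr //= [X in _ + X * _]big_geq // mul1r mulr_sumr.
  congr (_ + _); apply: eq_big_nat => t /andP[_ tk].
  by rewrite prodS // mulrA.
rewrite prodS // addrA lerD2r.
by rewrite -mulrA -mulrDr ler_wpM2l.
Qed.

(** * The global loss and the recursion for the optimality gap *)

Section Iteration.
Context {R : realType} {J M : nat} {net : network J}.
Variables (dataset : node net -> finType) (f : node net -> 'rV[R]_M -> R).
Hypothesis f_diff : forall n, n \in layer_set net J ->
  forall x, differentiable (f n) x.
Let D : R := (data_size dataset)%:R.

Lemma global_lossE :
  global_loss dataset f =
  fun x => \sum_(n in layer_set net J) (D^-1 * #|dataset n|%:R) * f n x.
Proof.
by apply/funext => x; rewrite /global_loss mulr_sumr; apply: eq_bigr => n _;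
  rewrite mulrA.
Qed.

Lemma global_loss_differentiable x : differentiable (global_loss dataset f) x.
Proof.
by rewrite global_lossE; apply: differentiable_lincomb => n /f_diff.
Qed.

Lemma grad_global_loss x : grad (global_loss dataset f) x =
  D^-1 *: \sum_(n in layer_set net J) #|dataset n|%:R *: grad (f n) x.
Proof.
rewrite global_lossE grad_lincomb => [|n /f_diff //].
by rewrite scaler_sumr; apply: eq_bigr => n _; rewrite scalerA.
Qed.

End Iteration.

Theorem proposition4 (R : realType) (J M : nat) (J_gt0 : (0 < J)%N)
  (net : network J)
  (dataset : node net -> finType)
  (dataset_neq0 : forall n, n \in layer_set net J -> (0 < #|dataset n|)%N)
  (f : node net -> 'rV[R]_M -> R)
  (f_diff : forall n, n \in layer_set net J ->
     forall x : 'rV[R]_M, differentiable (f n) x)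
  (mu eta c1 c2 : R) (mu_gt0 : 0 < mu) (mu_lt_eta : mu < eta)
  (F := global_loss dataset f)
  (F_sc : strongly_convex mu F) (F_smooth : smooth eta F)
  (wstar : 'rV[R]_M) (wstar_min : forall x : 'rV[R]_M, F wstar <= F x)
  (c1_ge0 : 0 <= c1) (c2_ge1 : 1 <= c2)
  (grad_bound : forall i, i \in layer_set net J -> forall x : 'rV[R]_M,
     enorm (grad (f i) x) ^+ 2 <= c1 + c2 * enorm (grad F x) ^+ 2)
  (lut : nat -> node net -> bool)
  (G : nat -> node net -> rel (node net))
  (theta : nat -> node net -> nat)
  (lambda : nat -> node net -> R)
  (V : forall (k : nat) (n : node net), 'M[R]_#|children net k n|)
  (G_connected : forall k n, (0 < k)%N -> (layer net n < J)%N -> lut k n ->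
     connected_graph_on (children net k n) (G k n))
  (V_consensus : forall k n, (0 < k)%N -> (layer net n < J)%N -> lut k n ->
     consensus_matrix (G k n) (lambda k n) (V k n))
  (beta : R) (beta_eq : beta = 1 / eta)
  (A : nat -> {set node net})
  (w : nat -> 'rV[R]_M) (wt : nat -> node net -> 'rV[R]_M)
  (run : mhfl_run dataset f A lut theta V beta w wt)
  (Upsilon : nat -> node net -> R)
  (divergence : forall k n, (0 < k)%N -> (layer net n < J)%N ->
     forall q q', q \in children net k n -> q' \in children net k n ->
     enorm (wt k q - wt k q') <= Upsilon k n)
  (D : R := (data_size dataset)%:R)
  (Ds : nat -> R := fun t => (active_data_size dataset A t)%:R)
  (rate : nat -> R := fun l =>
     1 - mu / eta + 8 * c2 / D ^+ 2 * (D - Ds l) ^+ 2)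
  (k : nat) (k_gt0 : (0 < k)%N) :
  F (w k) - F wstar <=
    (\prod_(1 <= l < k.+1) rate l) * (F (w 0%N) - F wstar)
    + \sum_(1 <= t < k.+1) (\prod_(t.+1 <= l < k.+1) rate l)
        * (eta * (Phi net)%:R / Ds t ^+ 2 * Xi A lut theta lambda Upsilon t
           + 4 / eta * ((D - Ds t) / D) ^+ 2 * c1).
Proof.
have eta_gt0 : 0 < eta by exact: lt_trans mu_lt_eta.
have rateE l : rate l = 1 - mu / eta + 8 * c2 * ((D - Ds l) / D) ^+ 2.
  by rewrite /rate expr_div_n; rewrite [in RHS]mulrA [in LHS]mulrAC.
apply: (affine_recursion (a := fun k => F (w k) - F wstar)) => [l|{k_gt0}k'].
  rewrite rateE; apply: addr_ge0; first by rewrite subr_ge0 ler_pdivrMr // mul1r ltW.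
  apply: mulr_ge0; [lra | exact: sqr_ge0].
(* The current iteration is renamed [k], keeping [k' = k.-1], the form in which the run refers to
   the previous model. *)
have [k'E k_gt0] : k' = k'.+1.-1 /\ (0 < k'.+1)%N by [].
move: (k'.+1) k'E k_gt0 => {}k k'E k_gt0.
have [A_neq0 A_sub] := run_engaged run k_gt0.
set x := w k'; pose g := grad F x.
pose K := (Phi net)%:R * Xi A lut theta lambda Upsilon k / Ds k ^+ 2.
have DsE : Ds k = \sum_(i in layer_set net J | engaged A k i) #|dataset i|%:R.
  by rewrite /Ds /active_data_size natr_sum.
have DE : D = \sum_(i in layer_set net J) #|dataset i|%:R.
  by rewrite /D /data_size natr_sum.
(* Some device is engaged and its dataset is nonempty, so the server's division is legitimate. *)
have Ds_gt0 : 0 < Ds k.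
  have [i ei] := exists_engaged k_gt0 J_gt0 A_sub A_neq0.
  have iJ : i \in layer_set net J.
    by rewrite in_layer (engaged_layer k_gt0 J_gt0 A_sub ei).
  rewrite DsE (bigD1 i) /= ?iJ ?ei // ltr_pwDl ?sumr_ge0 //.
  by rewrite ltr0n dataset_neq0.
pose s := \sum_(i in layer_set net J | engaged A k i)
  #|dataset i|%:R *: grad (f i) x.
pose e := wt k (server net)
  - \sum_(i in layer_set net J | engaged A k i) wt k i.
(* Sampling error plus consensus error; the latter is multiplied by [eta] to offset the step length
   [eta^-1]. *)
pose r := (g - (Ds k)^-1 *: s) + (eta / Ds k) *: e.
have wE : w k = x - eta^-1 *: (g - r).
  have wtE : wt k (server net) = Ds k *: x - eta^-1 *: s + e.
    (* Without consensus error, the engaged devices upload exactly [Ds k] times [x] minus the step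
       along [s]. *)
    suff <- : \sum_(i in layer_set net J | engaged A k i) wt k i =
        Ds k *: x - eta^-1 *: s by rewrite /e addrC subrK.
    rewrite DsE scaler_suml /s scaler_sumr -sumrB; apply: eq_bigr => i /andP[iJ ei].
    rewrite (run_device run k_gt0 iJ) ?(active_device k_gt0) // -k'E beta_eq.
    by rewrite scalerBr -/x mul1r scalerA mulrC -scalerA.
  have -> : g - r = (Ds k)^-1 *: s - (eta / Ds k) *: e.
    by rewrite /r opprD opprB addrA [g + _]addrC subrK.
  rewrite (run_server run k_gt0) -/(Ds k) wtE scalerDr !scalerBr !scalerA.
  rewrite mulVf ?gt_eqF // scale1r mulrA mulVf ?gt_eqF // mul1r.
  rewrite [eta^-1 / _]mulrC; set b := (Ds k)^-1 *: wt k _ - _.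
  by rewrite opprD opprK -addrA.
have e_le : dot e e <= (Phi net)%:R * Xi A lut theta lambda Upsilon k.
  exact: (aggregate_error J_gt0 V_consensus run divergence k_gt0).
have g_le : dot (g - (Ds k)^-1 *: s) (g - (Ds k)^-1 *: s) <=
    4 * ((D - Ds k) / D) ^+ 2 * (c1 + c2 * dot g g).
  (* The full weighted average of the local gradients is [g], and the gradient bound supplies the
     common bound on each of them. *)
  have := @weighted_avg_diff_le R M _ (mem (layer_set net J)) (engaged A k)
    (fun i => #|dataset i|%:R) (fun i => grad (f i) x) (c1 + c2 * dot g g).
  rewrite /= -DE -DsE /g (grad_global_loss dataset f_diff) -/D -/s; apply => //.
  move=> i iJ; rewrite -enorm_sqr -(grad_global_loss dataset f_diff) -enorm_sqr.
  exact: grad_bound.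
have r_le : dot r r <= 2 * eta ^+ 2 * K
    + 8 * ((D - Ds k) / D) ^+ 2 * (c1 + c2 * dot g g).
  (* Splitting [r] doubles both errors, so the 4 of the sampling bound becomes 8. *)
  apply: (le_trans (dot_add_le _ _)); rewrite dotZl dotZr [eta / Ds k * _]mulrA -expr2.
  have : (eta / Ds k) ^+ 2 * dot e e <= eta ^+ 2 * K.
    have -> : eta ^+ 2 * K = (eta / Ds k) ^+ 2 *
        ((Phi net)%:R * Xi A lut theta lambda Upsilon k).
      by rewrite /K; field; rewrite gt_eqF.
    by rewrite ler_wpM2l ?sqr_ge0.
  lra.
have c2_ge0 : 0 <= c2 by lra.
have := inexact_step_contraction mu_gt0 eta_gt0 c2_ge0
  (global_loss_differentiable dataset f_diff) F_sc F_smooth wstar_min r_le.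
rewrite -wE -rateE => /le_trans; apply.
rewrite lerD2l lerD2r le_eqVlt /K; apply/orP; left; apply/eqP.
by field; rewrite gt_eqF.
Qed.
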